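(* Let $\gamma^\delta>0$. Put $$M^\delta:=\max\Big(1,\max_{1\le i\le k}\lambda_{\max}(K_i^\delta A_i^\delta)\Big),\qquad m^\delta:=\min\Big(1,\min_{1\le i\le k}\lambda_{\min}(K_i^\delta A_i^\delta)\Big).$$ For $f=(f_i)_{1\le i\le m}\in Y'$, let $u:=G^{-1}f$ and $$u^\delta:=\operatorname*{argmin}_{z\in X^\delta}\tfrac12\Big(\sum_{i=1}^k\ \sup_{0\ne y_i\in Y_i^\delta}\frac{|(G_iz-f_i)(y_i)|^2}{\|y_i\|_{Y_i^\delta}^2}+\sum_{i=k+1}^m\|G_iz-f_i\|_{Y_i'}^2\Big).$$ Then $$|\!|\!|u-u^\delta|\!|\!|_X\le\frac{\sqrt{M^\delta}}{\gamma^\delta\sqrt{m^\delta}}\inf_{w\in X^\delta}|\!|\!|u-w|\!|\!|_X,$$ and so $$\|u-u^\delta\|_X\le\sqrt{\frac{M^\delta}{m^\delta}}\ \frac{\|G\|_{\mathcal L(X,Y')}\,\|G^{-1}\|_{\mathcal L(Y',X)}}{\gamma^\delta}\inf_{w\in X^\delta}\|u-w\|_X.$$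
   Context: Let $0\le k\le m$, $m\ge1$, and let $X$ and $Y_1,\dots,Y_m$ be real Hilbert spaces. Set $Y:=Y_1\times\cdots\times Y_m$ with $\|y\|_Y^2=\sum_{i=1}^m\|y_i\|_{Y_i}^2$, so that $Y'=Y_1'\times\cdots\times Y_m'$ with $\|g\|_{Y'}^2=\sum_i\|g_i\|_{Y_i'}^2$ and $g(y)=\sum_i g_i(y_i)$. Let $G=(G_1,\dots,G_m)\colon X\to Y'$, with $G_i\in\mathcal L(X,Y_i')$, be a boundedly invertible linear operator. (For $k+1\le i\le m$ the residual component is originally given with values in $Y_i$ and measured in $\|\cdot\|_{Y_i}$; it is identified with an element of $Y_i'$ through the isometric Riesz map, so that $\|\cdot\|_{Y_i'}$ of it equals the original $Y_i$-norm.) Let $X^\delta\subset X$ be a finite dimensional subspace. For $1\le i\le k$ let $Y_i^\delta\subset Y_i$ be a finite dimensional subspace, and for $k+1\le i\le m$ let $Y_i^\delta:=Y_i$. Set $Y^\delta:=Y_1^\delta\times\cdots\times Y_m^\delta$, $$\gamma^\delta:=\inf_{\{z\in X^\delta:\ Gz\ne0\}}\frac{\sup_{0\ne y\in Y^\delta}\frac{|(Gz)(y)|}{\|y\|_Y}}{\|Gz\|_{Y'}},$$ and $|\!|\!|\cdot|\!|\!|_X:=\|G\,\cdot\|_{Y'}$. For $1\le i\le k$, $A_i^\delta\colon Y_i^\delta\to (Y_i^\delta)'$ is defined by $(A_i^\delta v)(\tilde v)=\langle v,\tilde v\rangle_{Y_i}$, and $K_i^\delta=(K_i^\delta)'\colon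 (Y_i^\delta)'\to Y_i^\delta$ is a given boundedly invertible, self-adjoint linear operator for which $\langle v,\tilde v\rangle_{Y_i^\delta}:=((K_i^\delta)^{-1}v)(\tilde v)$ is a scalar product on $Y_i^\delta$; its norm is denoted $\|\cdot\|_{Y_i^\delta}$. $\lambda_{\min}(K_i^\delta A_i^\delta)$ and $\lambda_{\max}(K_i^\delta A_i^\delta)$ denote the smallest and largest eigenvalue of $K_i^\delta A_i^\delta$. *)

(* Defs.v *)
From HB Require Import structures.
From mathcomp Require Import all_boot all_order all_algebra.
From mathcomp Require Import all_classical all_reals.
From mathcomp Require Import ereal topology normedtype.
From mathcomp Require Import ring.

Set Implicit Arguments.
Unset Strict Implicit.
Unset Printing Implicit Defensive.

Import Order.TTheory GRing.Theory Num.Theory numFieldNormedType.Exports.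

Local Open Scope classical_set_scope.
Local Open Scope ring_scope.

HB.mixin Record NormedModule_isPreHilbert (R : realType) V
    & NormedModule R V := {
  inner : {dot V for (@idfun R)} ;
  inner_normE : forall x : V, inner x x = `|x| ^+ 2
}.

#[short(type="preHilbertType")]
HB.structure Definition PreHilbert (R : realType) :=
  {V of NormedModule R V & NormedModule_isPreHilbert R V}.

#[short(type="hilbertType")]
HB.structure Definition Hilbert (R : realType) :=
  {V of PreHilbert R V & CompleteNormedModule R V}.

Section inner_theory.
Variables (R : realType) (V : preHilbertType R).
Implicit Types x y z : V.

Lemma innerC x y : inner x y = inner y x.
Proof.
by rewrite [LHS](@hermitian_subproof R V false idfun inner) expr0 mul1r.
Qed.

Lemma inner_is_linear x : linear (inner x : V -> R^o).
Proof. by move=> a y z; rewrite (@linearPr _ _ _ _ _ _ inner). Qed.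

HB.instance Definition _ x := @GRing.isLinear.Build R V R^o *:%R
  (inner x : V -> R^o) (inner_is_linear x).

Lemma innerZDl a x y z : inner (a *: x + y) z = a * inner x z + inner y z.
Proof. by rewrite !(innerC _ z); exact: inner_is_linear. Qed.

Lemma CauchySchwarz_inner x y : `|inner x y| <= `|x| * `|y|.
Proof.
have [->|y0] := eqVneq y 0.
  by rewrite normr0 mulr0 -[inner x]/(inner x : V -> R^o) linear0 normr0.
have n0 : 0 < `|y| ^+ 2 by rewrite exprn_gt0// normr_gt0.
rewrite -(@ler_pXn2r _ 2)// ?nnegrE ?mulr_ge0// real_normK ?num_real//.
rewrite exprMn -ler_pdivrMr//.
have : 0 <= inner (- (inner x y / `|y| ^+ 2) *: y + x)
                  (- (inner x y / `|y| ^+ 2) *: y + x).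
  by rewrite inner_normE sqr_ge0.
rewrite innerZDl 2!inner_is_linear (innerC y x) !inner_normE.
rewrite /GRing.scale/=.
set s := inner x y; set Q := `|y| ^+ 2 in n0 *; set P := `|x| ^+ 2.
have -> : - (s / Q) * (- (s / Q) * Q + s) + (- (s / Q) * s + P) = P - s ^+ 2 / Q.
  by rewrite [X in _ * (X + _)]mulNr divfK ?gt_eqF// addNr mulr0 add0r addrC mulNr
    mulrAC -expr2.
by rewrite subr_ge0.
Qed.

End inner_theory.

Section opnorm.
Variables (R : realType) (V W : normedModType R).

(* For the zero space the supremum runs over the empty set and is [0]. *)
Definition opnorm (f : V -> W) : R :=
  sup [set `|f x| / `|x| | x in [set x | x != 0]].

Lemma opnorm_le (f : V -> W) (M : R) : 0 <= M ->
  (forall x, `|f x| <= M * `|x|) -> opnorm f <= M.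
Proof.
move=> M0 fM; have [S0|S0] :=
  eqVneq [set `|f x| / `|x| | x in [set x | x != 0]] set0.
  by rewrite /opnorm S0 sup0.
apply: ge_sup; first exact/set0P.
by move=> _ [x /= x0 <-]; rewrite ler_pdivrMr ?normr_gt0.
Qed.

Lemma le_opnorm (f : {linear V -> W}) (x : V) : continuous f ->
  `|f x| <= opnorm f * `|x|.
Proof.
move=> /linear_bounded_continuous/linear_boundedP/pinfty_ex_gt0[M M0 fM].
have [->|x0] := eqVneq x 0; first by rewrite linear0 !normr0 mulr0.
rewrite -ler_pdivrMr ?normr_gt0//; apply: ub_le_sup; last by exists x.
by exists M => _ [y /= y0 <-]; rewrite ler_pdivrMr ?normr_gt0.
Qed.

Lemma opnorm_ge0 (f : V -> W) : 0 <= opnorm f.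
Proof.
rewrite /opnorm; set S := (X in sup X).
have [[S0 Sub]|/sup_out->//] := pselect (has_sup S).
have [y Sy] := S0; have [x _ yE] := Sy.
by apply: le_trans (ub_le_sup Sub Sy); rewrite -yE divr_ge0.
Qed.

End opnorm.

Definition bounded_inverse (R : realType) (V W : normedModType R)
    (f : V -> W) (g : W -> V) : Prop :=
  [/\ continuous f, continuous g, cancel f g & cancel g f].

Definition continuous_functional (R : realType) (V : normedModType R) :
    {pred V -> R^o} :=
  fun f => `[< linear f /\ continuous f >].

Section continuous_functional.
Variables (R : realType) (V : normedModType R).

Lemma continuous_functional_submod : submod_closed (@continuous_functional R V).
Proof.
split.
  apply/asboolP; split; first by move=> a x y; rewrite /= scaler0 addr0.
  exact: cst_continuous.
move=> a f g /asboolP[lf cf] /asboolP[lg cg]; apply/asboolP; split.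
  move=> b x y; change (a *: f (b *: x + y) + g (b *: x + y) =
    b *: (a *: f x + g x) + (a *: f y + g y)); rewrite lf lg.
  by rewrite !scalerDr addrACA !scalerA [a * b]mulrC.
move=> x; apply: (@continuousD R R^o V (a *: f) g x); last exact: cg.
by apply: continuousZr; exact: cf.
Qed.

HB.instance Definition _ := GRing.isSubmodClosed.Build R (V -> R^o)
  (@continuous_functional R V) continuous_functional_submod.

Record dual := Dual {
  dual_fun :> V -> R^o ;
  dual_funP : dual_fun \in @continuous_functional R V
}.

HB.instance Definition _ := [isSub for dual_fun].
HB.instance Definition _ := [Choice of dual by <:].
HB.instance Definition _ := [SubChoice_isSubLmodule of dual by <:].

Lemma dual_linear (g : dual) : linear g.
Proof. by case/asboolP: (dual_funP g). Qed.

Lemma dual_continuous (g : dual) : continuous g.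
Proof. by case/asboolP: (dual_funP g). Qed.

HB.instance Definition _ (g : dual) :=
  GRing.isLinear.Build R V R^o *:%R (dual_fun g) (dual_linear g).

Definition dual_norm (g : dual) : R := opnorm g.

Lemma le_dual_norm (g : dual) x : `|g x| <= dual_norm g * `|x|.
Proof. exact/(le_opnorm (f := dual_fun g))/dual_continuous. Qed.

Lemma ler_dual_normD g h : dual_norm (g + h) <= dual_norm g + dual_norm h.
Proof.
apply: opnorm_le => [|x]; first by rewrite addr_ge0// opnorm_ge0.
rewrite mulrDl; apply: le_trans (lerD (le_dual_norm g x) (le_dual_norm h x)).
exact: ler_normD.
Qed.

Lemma dual_normZ (a : R) g : dual_norm (a *: g) = `|a| * dual_norm g.
Proof.
have leZ (b : R) h : dual_norm (b *: h) <= `|b| * dual_norm h.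
  apply: opnorm_le => [|x]; first by rewrite mulr_ge0// opnorm_ge0.
  rewrite -[(b *: h) x]/(b *: h x) normrZ -mulrA ler_wpM2l//.
  exact: le_dual_norm.
have [->|a0] := eqVneq a 0.
  apply/eqP; rewrite normr0 mul0r eq_le opnorm_ge0 andbT.
  by apply: le_trans (leZ _ _) _; rewrite normr0 mul0r.
apply/eqP; rewrite eq_le leZ/= -ler_pdivlMl ?normr_gt0// -normfV.
by rewrite -{1}[g]scale1r -(mulVf a0) -scalerA leZ.
Qed.

Lemma dual_norm0_eq0 g : dual_norm g = 0 -> g = 0.
Proof.
move=> g0; apply/val_inj/funext => x.
by have := le_dual_norm g x; rewrite g0 mul0r normr_le0 => /eqP.
Qed.

HB.instance Definition _ := Lmodule_isNormed.Build R dual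
  ler_dual_normD dual_normZ dual_norm0_eq0.

End continuous_functional.

Section riesz.
Variables (R : realType) (V : preHilbertType R).

Lemma riesz_subproof (v : V) : (inner v : V -> R^o) \in @continuous_functional R V.
Proof.
apply/asboolP; split; first exact: inner_is_linear.
apply: (@bounded_linear_continuous _ _ _ (inner v : {linear V -> R^o})).
apply/linear_boundedP; near=> r => x.
apply: le_trans (CauchySchwarz_inner v x) _.
by rewrite ler_wpM2r//; near: r; apply: nbhs_pinfty_ge; rewrite num_real.
Unshelve. all: by end_near. Qed.

Definition riesz (v : V) : dual V := Dual (riesz_subproof v).

Lemma riesz_is_linear : linear riesz.
Proof. by move=> a v w; apply/val_inj/funext => x; exact: innerZDl. Qed.

HB.instance Definition _ :=
  GRing.isLinear.Build R V (dual V) *:%R riesz riesz_is_linear.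

End riesz.

Definition l2prod (R : realType) (I : finType) (V : I -> normedModType R) :=
  forall i, V i.

Section l2prod.
Variables (R : realType) (I : finType) (V : I -> normedModType R).
Local Notation T := (l2prod V).

HB.instance Definition _ := gen_eqMixin T.
HB.instance Definition _ := gen_choiceMixin T.

Definition l2prod_zero : T := fun=> 0.
Definition l2prod_add (x y : T) : T := fun i => x i + y i.
Definition l2prod_opp (x : T) : T := fun i => - x i.
Definition l2prod_scale (a : R) (x : T) : T := fun i => a *: x i.

Lemma l2prod_addA : associative l2prod_add.
Proof. by move=> x y z; apply/functional_extensionality_dep => i; exact: addrA. Qed.
Lemma l2prod_addC : commutative l2prod_add.
Proof. by move=> x y; apply/functional_extensionality_dep => i; exact: addrC. Qed.
Lemma l2prod_add0 : left_id l2prod_zero l2prod_add.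
Proof. by move=> x; apply/functional_extensionality_dep => i; exact: add0r. Qed.
Lemma l2prod_addN : left_inverse l2prod_zero l2prod_opp l2prod_add.
Proof. by move=> x; apply/functional_extensionality_dep => i; exact: addNr. Qed.

HB.instance Definition _ :=
  GRing.isZmodule.Build T l2prod_addA l2prod_addC l2prod_add0 l2prod_addN.

Lemma l2prod_scaleA a b x :
  l2prod_scale a (l2prod_scale b x) = l2prod_scale (a * b) x.
Proof. by apply/functional_extensionality_dep => i; exact: scalerA. Qed.
Lemma l2prod_scale1 : left_id 1 l2prod_scale.
Proof. by move=> x; apply/functional_extensionality_dep => i; exact: scale1r. Qed.
Lemma l2prod_scaleDr : right_distributive l2prod_scale +%R.
Proof. by move=> a x y; apply/functional_extensionality_dep => i; exact: scalerDr. Qed.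
Lemma l2prod_scaleDl x : {morph l2prod_scale^~ x : a b / a + b}.
Proof. by move=> a b; apply/functional_extensionality_dep => i; exact: scalerDl. Qed.

HB.instance Definition _ := GRing.Zmodule_isLmodule.Build R T
  l2prod_scaleA l2prod_scale1 l2prod_scaleDr l2prod_scaleDl.

Definition l2norm (x : T) : R := Num.sqrt (\sum_i `|x i| ^+ 2).

Lemma CauchySchwarz_sum (a b : I -> R) :
  (\sum_i a i * b i) ^+ 2 <= (\sum_i a i ^+ 2) * (\sum_i b i ^+ 2).
Proof.
set A := \sum_i a i ^+ 2; set B := \sum_i b i ^+ 2; set C := \sum_i a i * b i.
have B0 : 0 <= B by apply: sumr_ge0 => i _; exact: sqr_ge0.
have [B_eq0|Bn0] := eqVneq B 0.
  have b0 i : b i = 0.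
    apply/eqP; rewrite -sqrf_eq0; apply/eqP.
    by apply: (psumr_eq0P _ B_eq0) => // j _; exact: sqr_ge0.
  by rewrite /C big1 ?expr0n ?B_eq0 ?mulr0// => i _; rewrite b0 mulr0.
have Bp : 0 < B by rewrite lt_neqAle eq_sym Bn0.
have : 0 <= \sum_i (B * a i - C * b i) ^+ 2.
  by apply: sumr_ge0 => i _; exact: sqr_ge0.
under eq_bigr => i _ do rewrite sqrrB !exprMn.
rewrite big_split/= sumrB -!mulr_sumr -/A -/B.
have -> : \sum_i B * a i * (C * b i) *+ 2 = (B * C * C) *+ 2.
  rewrite sumrMnl; congr (_ *+ 2); rewrite mulr_sumr.
  by apply: eq_bigr => i _; rewrite mulrACA.
have -> : B ^+ 2 * A - (B * C * C) *+ 2 + C ^+ 2 * B = B * (A * B - C ^+ 2).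
  by ring.
by rewrite pmulr_rge0// subr_ge0.
Qed.

Lemma ler_l2normD x y : l2norm (x + y) <= l2norm x + l2norm y.
Proof.
have S0 (z : T) : 0 <= \sum_i `|z i| ^+ 2.
  by apply: sumr_ge0 => i _; exact: sqr_ge0.
rewrite -(@ler_pXn2r _ 2)// ?nnegrE ?addr_ge0 ?sqrtr_ge0//.
rewrite sqrrD !sqr_sqrtr//.
apply: (@le_trans _ _ (\sum_i (`|x i| + `|y i|) ^+ 2)).
  by apply: ler_sum => i _; rewrite ler_sqr ?nnegrE ?addr_ge0//; exact: ler_normD.
under eq_bigr => i _ do rewrite sqrrD.
rewrite 2!big_split/= sumrMnl !lerD2r lerD2l lerMn2r/= -sqrtrM//.
by apply: le_trans (ler_norm _) _; rewrite -sqrtr_sqr ler_wsqrtr// CauchySchwarz_sum.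
Qed.

Lemma l2normZ (a : R) x : l2norm (a *: x) = `|a| * l2norm x.
Proof.
rewrite /l2norm -sqrtr_sqr -sqrtrM ?sqr_ge0// mulr_sumr.
congr Num.sqrt; apply: eq_bigr => i _.
by rewrite normrZ exprMn real_normK ?num_real.
Qed.

Lemma l2norm0_eq0 x : l2norm x = 0 -> x = 0.
Proof.
move/eqP; rewrite sqrtr_eq0 => x0; apply/functional_extensionality_dep => i.
apply/eqP; rewrite -normr_eq0 -sqrf_eq0; apply/eqP.
apply: (@psumr_eq0P _ _ predT (fun i => `|x i| ^+ 2)) => //.
by apply/eqP; rewrite eq_le x0 sumr_ge0// => j _; exact: sqr_ge0.
Qed.

HB.instance Definition _ := Lmodule_isNormed.Build R T
  ler_l2normD l2normZ l2norm0_eq0.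

End l2prod.

(* Through this action, [l2prod (fun i => dual (V i))] is the dual of
   [l2prod V], with its dual norm. *)
Definition pairing (R : realType) (I : finType) (V : I -> normedModType R)
    (g : l2prod (fun i => dual (V i))) (y : l2prod V) : R :=
  \sum_i g i (y i).

Record fdsubspace (R : realType) (V : preHilbertType R) := FDSubspace {
  fd_mem :> {pred V} ;
  fd_submod : submod_closed fd_mem ;
  fd_span : exists (n : nat) (e : 'I_n -> V), forall v, v \in fd_mem ->
    exists c : 'I_n -> R, v = \sum_(i < n) c i *: e i
}.

Section fdsubspace.
Variables (R : realType) (V : preHilbertType R) (W : fdsubspace V).

HB.instance Definition _ :=
  GRing.isSubmodClosed.Build R V (fd_mem W) (fd_submod W).

Record fd_sort := FDSort { fd_val : V ; fd_valP : fd_val \in fd_mem W }.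

HB.instance Definition _ := [isSub for fd_val].
HB.instance Definition _ := [Choice of fd_sort by <:].
HB.instance Definition _ := [SubChoice_isSubLmodule of fd_sort by <:].

Definition fd_norm (w : fd_sort) : R := `|fd_val w|.

Lemma ler_fd_normD v w : fd_norm (v + w) <= fd_norm v + fd_norm w.
Proof. exact: ler_normD. Qed.
Lemma fd_normZ (a : R) w : fd_norm (a *: w) = `|a| * fd_norm w.
Proof. exact: normrZ. Qed.
Lemma fd_norm0_eq0 w : fd_norm w = 0 -> w = 0.
Proof. by move/normr0_eq0 => w0; exact: val_inj. Qed.

HB.instance Definition _ := Lmodule_isNormed.Build R fd_sort
  ler_fd_normD fd_normZ fd_norm0_eq0.

Definition fd_inner (v w : fd_sort) : R := inner (fd_val v) (fd_val w).

Lemma fd_inner_bilinear :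
  bilinear_for (GRing.Scale.Law.clone _ _ *%R _)
    (GRing.Scale.Law.clone _ _ (idfun \; *%R) _) fd_inner.
Proof.
split=> [w a u v|w a u v]; first exact: innerZDl.
exact: inner_is_linear.
Qed.

HB.instance Definition _ :=
  bilinear_isBilinear.Build R fd_sort fd_sort R _ _ fd_inner fd_inner_bilinear.

Lemma fd_inner_sym v w : fd_inner v w = (-1) ^+ false * idfun (fd_inner w v).
Proof. by rewrite expr0 mul1r; exact: innerC. Qed.

HB.instance Definition _ :=
  isHermitianSesquilinear.Build R fd_sort false idfun fd_inner fd_inner_sym.

Lemma fd_inner_gt0 w : w != 0 -> 0 < fd_inner w w.
Proof. by move=> w0; rewrite /fd_inner inner_normE exprn_gt0// (normr_gt0 w). Qed.

HB.instance Definition _ :=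
  isDotProduct.Build R fd_sort fd_inner fd_inner_gt0.

Lemma fd_inner_normE w : fd_inner w w = `|w| ^+ 2.
Proof. exact: inner_normE. Qed.

HB.instance Definition _ :=
  NormedModule_isPreHilbert.Build R fd_sort fd_inner_normE.

End fdsubspace.

Coercion fd_sort : fdsubspace >-> Sortclass.

Section eigenvalues.
Variables (R : realType) (V : lmodType R).

Definition eigenvalues (T : V -> V) : set R :=
  [set l | exists2 v, v != 0 & T v = l *: v].

(* On a nonzero space these are used for operators with finitely many and at
   least one eigenvalue, so that the bounds are attained; on the zero space
   they are [-oo] and [+oo], the neutral elements of [maxe] and [mine]. *)
Definition lambda_max (T : V -> V) : \bar R := ereal_sup (EFin @` eigenvalues T).
Definition lambda_min (T : V -> V) : \bar R := ereal_inf (EFin @` eigenvalues T).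

End eigenvalues.

Definition is_scalar_product (R : realType) (V : lmodType R) (p : V -> V -> R) :=
  [/\ forall x y, p x y = p y x,
      forall a x y z, p (a *: x + y) z = a * p x z + p y z &
      forall x, x != 0 -> 0 < p x x].

(* The scalar product [<v, w> := (K^-1 v) w] induced by [Kinv = K^-1]. *)
Definition precond_inner (R : realType) (W : normedModType R)
  (Kinv : W -> dual W) (v w : W) : R := Kinv v w.

Definition argmin (R : realType) (T : Type) (D : set T) (J : T -> R) : set T :=
  [set z | D z /\ forall w, D w -> J z <= J w].

Section least_squares.
Variables (R : realType) (k m : nat) (hkm : (k <= m)%N).
Variables (X : hilbertType R) (Y : 'I_m -> hilbertType R).
Variable G : X -> l2prod (fun i => dual (Y i)).
Variable Xd : fdsubspace X.

Local Notation wid := (widen_ord hkm).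

Variable Yd : forall i : 'I_k, fdsubspace (Y (wid i)).

(* [Yd i] in the first [k] factors and the whole of [Y i] in the others. *)
Definition prod_subspace : set (l2prod Y) :=
  [set y | forall i : 'I_k, y (wid i) \in Yd i].

(* If [G z = 0] for all [z] in [Xd], in particular if [Xd] is zero, then the
   infimum runs over the empty set and is [0]. *)
Definition infsup : R :=
  inf [set sup [set `|pairing (G z) y| / `|y| |
                 y in [set y | prod_subspace y /\ y != 0]] / `|G z| |
        z in [set z | z \in Xd /\ G z != 0]].

Variable K : forall i : 'I_k, dual (Yd i) -> Yd i.

Definition eig_max : R :=
  fine (\big[maxe/1%E]_(i < k) lambda_max (@K i \o @riesz R (Yd i))).
Definition eig_min : R :=
  fine (\big[mine/1%E]_(i < k) lambda_min (@K i \o @riesz R (Yd i))).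

Variable Kinv : forall i : 'I_k, Yd i -> dual (Yd i).

Definition ls_functional (f : l2prod (fun i => dual (Y i))) (z : X) : R :=
  2^-1 * (\sum_(i < k)
            sup [set `|(G z (wid i) - f (wid i)) (fd_val y)| ^+ 2
                       / precond_inner (@Kinv i) y y | y in [set y : Yd i | y != 0]]
          + \sum_(i < m | (k <= i)%N) `|G z i - f i| ^+ 2).

End least_squares.

(* Main.v *)
Require Import Defs.
From HB Require Import structures.
From mathcomp Require Import all_boot all_order all_algebra.
From mathcomp Require Import all_classical all_reals.
From mathcomp Require Import ereal topology normedtype.
From mathcomp Require Import ring lra.
Import Order.TTheory GRing.Theory Num.Theory numFieldNormedType.Exports.
Local Open Scope classical_set_scope.
Local Open Scope ring_scope.

(** Write [a x y] for the scalar product behind [`|G x|] and [b x y] for the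
    form obtained from the minimised functional: since [f = G u], the functional
    at [z] is half of [b (z - u) (z - u)].  Hence [ud] is the [b]-orthogonal
    projection of [u] onto the discrete space.

    That [a] and [b] are quadratic forms at all rests on Riesz representation
    ([riesz_surjective]), which makes a squared dual norm a quadratic form, and
    on [sup_precond]: the supremum of [|h y|^2 / <y, y>] for the scalar product
    induced by the inverse of [K] is [h (K h)].

    By [rayleigh_le] and [rayleigh_ge], [h (K h)] lies between the extreme
    eigenvalues of [K] composed with the Riesz map times [`|h| ^+ 2]; the
    components that are measured exactly account for the value 1 in [M] and
    [mu].  So [b] lies between [mu] and [M] times the squared norm of the
    residual as a functional on the discrete test space ([ls_form_le],
    [ls_form_ge]).  The latter is at most [a], and on the discrete trial space
    the inf-sup condition bounds it below by [gamma ^+ 2] times [a]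
    ([infsup_le]).

    The oblique projector [P] that maps [u] to [ud] thus satisfies
    [L * a (P x) (P x) <= b (P x) (P x) <= b x x <= M * a x x] with
    [L = gamma ^+ 2 * mu], so its [a]-norm is at most [sqrt (M / L)].  A
    triangle inequality would now lose an additive 1; the stated constant comes
    from the fact that a projector other than 0 and the identity on a Hilbert
    space has the same norm as its complement.  [quasi_optimality] proves the
    resulting bound directly.  The second estimate follows from the first one
    and the boundedness of [G] and of its inverse. *)

Set Implicit Arguments.
Unset Strict Implicit.
Unset Printing Implicit Defensive.

(** * Positive semidefinite forms *)

(** Only semidefinite: the least-squares form may vanish on nonzero vectors that
    lie outside the trial space. *)
Definition psd_form (R : realType) (V : lmodType R) (b : V -> V -> R) :=
  [/\ forall x y, b x y = b y x,
      forall a x y z, b (a *: x + y) z = a * b x z + b y z &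
      forall x, 0 <= b x x].

Section forms.
Variables (R : realType) (V : lmodType R) (b : V -> V -> R).
Hypothesis hb : psd_form b.

Lemma psdC x y : b x y = b y x. Proof. by case: hb. Qed.
Lemma psd_ge0 x : 0 <= b x x. Proof. by case: hb. Qed.
Lemma psdPl a x y z : b (a *: x + y) z = a * b x z + b y z.
Proof. by case: hb. Qed.
Lemma psdDl x y z : b (x + y) z = b x z + b y z.
Proof. by rewrite -[x]scale1r psdPl mul1r scale1r. Qed.
Lemma psd0l z : b 0 z = 0.
Proof. by apply: (@addrI _ (b 0 z)); rewrite -psdDl !addr0. Qed.
Lemma psdZl a x z : b (a *: x) z = a * b x z.
Proof. by rewrite -[a *: x]addr0 psdPl psd0l addr0. Qed.
Lemma psdNl x z : b (- x) z = - b x z.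
Proof. by rewrite -scaleN1r psdZl mulN1r. Qed.
Lemma psdBl x y z : b (x - y) z = b x z - b y z.
Proof. by rewrite psdDl psdNl. Qed.
Lemma psdDr x y z : b z (x + y) = b z x + b z y.
Proof. by rewrite psdC psdDl !(psdC z). Qed.
Lemma psdZr a x z : b z (a *: x) = a * b z x.
Proof. by rewrite psdC psdZl psdC. Qed.
Lemma psdBr x y z : b z (x - y) = b z x - b z y.
Proof. by rewrite psdC psdBl !(psdC z). Qed.
Lemma psd_suml (I : finType) (F : I -> V) z :
  b (\sum_i F i) z = \sum_i b (F i) z.
Proof.
elim/big_ind2: _ => [|x1 y1 x2 y2 <- <-|//]; first exact: psd0l.
exact: psdDl.
Qed.

Lemma psd_expand s t x y : b (s *: x + t *: y) (s *: x + t *: y) =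
  s ^+ 2 * b x x + (s * t * b x y) *+ 2 + t ^+ 2 * b y y.
Proof.
by rewrite psdDl !psdDr !psdZl !psdZr (psdC y x); ring.
Qed.

Lemma psd_CauchySchwarz x y : b x y ^+ 2 <= b x x * b y y.
Proof.
have H s t : 0 <= s ^+ 2 * b x x + (s * t * b x y) *+ 2 + t ^+ 2 * b y y.
  by rewrite -psd_expand psd_ge0.
have := psd_ge0 x; have := psd_ge0 y.
move: H; set A := b x x; set B := b x y; set C := b y y => H C0 A0.
have [C_eq0|Cn0] := eqVneq C 0.
  have [->|Bn0] := eqVneq B 0; first by rewrite C_eq0 mulr0 expr0n.
  (* With [C = 0] the form is affine in [t]; this [t] makes it negative. *)
  have := H 1 (- (A + 1) / (2 * B)); rewrite C_eq0.
  have -> : 1 ^+ 2 * A + 1 * (- (A + 1) / (2 * B)) * B *+ 2 +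
     (- (A + 1) / (2 * B)) ^+ 2 * 0 = -1 by field.
  by rewrite ler0N1.
have Cp : 0 < C by rewrite lt_neqAle eq_sym Cn0.
have := H C (- B).
have -> : C ^+ 2 * A + C * - B * B *+ 2 + (- B) ^+ 2 * C = C * (A * C - B ^+ 2).
  by ring.
by rewrite pmulr_rge0// subr_ge0.
Qed.

End forms.

Lemma psd_comp (R : realType) (V W : lmodType R) (F : V -> W) (b : W -> W -> R) :
  linear F -> psd_form b -> psd_form (fun x y => b (F x) (F y)).
Proof.
move=> Fl hb; split=> [x y|a x y z|x]; first exact: psdC.
  by rewrite Fl psdPl.
exact: psd_ge0.
Qed.

Lemma psdD (R : realType) (V : lmodType R) (b c : V -> V -> R) :
  psd_form b -> psd_form c -> psd_form (fun x y => b x y + c x y).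
Proof.
move=> hb hc; split=> [x y|a x y z|x].
- by rewrite (psdC hb) (psdC hc).
- by rewrite (psdPl hb) (psdPl hc) mulrDr addrACA.
- by rewrite addr_ge0 ?psd_ge0.
Qed.

Lemma psd_sum (R : realType) (V : lmodType R) (I : finType) (P : pred I)
  (b : I -> V -> V -> R) :
  (forall i, P i -> psd_form (b i)) -> psd_form (fun x y => \sum_(i | P i) b i x y).
Proof.
move=> hb; split=> [x y|a x y z|x].
- by apply: eq_bigr => i Pi; rewrite (psdC (hb i Pi)).
- rewrite mulr_sumr -big_split; apply: eq_bigr => i Pi.
  by rewrite (psdPl (hb i Pi)).
- by rewrite sumr_ge0// => i Pi; exact: psd_ge0 (hb i Pi) x.
Qed.

(** * Orthonormal bases and projections *)

Definition orthonormal_basis (R : realType) (V : lmodType R) (b : V -> V -> R)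
    (D : {pred V}) (n : nat) (e : 'I_n -> V) :=
  [/\ forall i, e i \in D, forall i j, b (e i) (e j) = (i == j)%:R &
      forall v, v \in D -> v = \sum_i b v (e i) *: e i].

Section gram_schmidt.
Variables (R : realType) (V : lmodType R) (b : V -> V -> R) (D : {pred V}).
Hypotheses (hb : psd_form b) (hD : submod_closed D).
Hypothesis b_definite : forall v, v \in D -> b v v = 0 -> v = 0.

(** The coefficients of the [e i] on the [s j] form an [r] by [n] matrix; if
    [n < r], a nonzero left kernel vector is a linear relation between the
    [e i]. *)
Lemma orthonormal_size (n r : nat) (s : 'I_n -> V) (e : 'I_r -> V) :
  (forall i, exists c : 'I_n -> R, e i = \sum_(j < n) c j *: s j) ->
  (forall i j, b (e i) (e j) = (i == j)%:R) -> (r <= n)%N.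
Proof.
move=> /choice[c ec] eo; rewrite leqNgt; apply/negP => nr.
pose C : 'M[R]_(r, n) := \matrix_(i, j) c i j.
have : kermx C != 0.
  rewrite kermx_eq0 -row_leq_rank -ltnNge.
  exact: (leq_ltn_trans (rank_leq_col C) nr).
case/matrix0Pn => i0 [j0].
pose d i := kermx C i0 i.
have dC j : \sum_i d i * c i j = 0.
  have : (kermx C *m C) i0 j = 0 by rewrite mulmx_ker mxE.
  by rewrite mxE => kC; rewrite -[RHS]kC; apply: eq_bigr => i _; rewrite [C i j]mxE.
have de0 : \sum_i d i *: e i = 0.
  under eq_bigr => i _ do rewrite ec scaler_sumr.
  rewrite exchange_big/= big1// => j _.
  under eq_bigr => i _ do rewrite scalerA.
  by rewrite -scaler_suml dC scale0r.
have : b (\sum_i d i *: e i) (e j0) = d j0.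
  rewrite psd_suml// (bigD1 j0)//= big1 ?addr0 => [|i ij].
    by rewrite psdZl// eo eqxx mulr1.
  by rewrite psdZl// eo (negPf ij) mulr0.
by rewrite de0 psd0l// /d => <-; rewrite eqxx.
Qed.

(** An orthonormal family in [D] of maximal size spans [D]: otherwise the
    normalised residual of some vector of [D] would extend it.  The spanning
    vectors [s j] need not belong to [D], which rules out orthogonalising them
    one by one. *)
Lemma ex_orthonormal_basis :
  (exists n (s : 'I_n -> V), forall v, v \in D ->
     exists c : 'I_n -> R, v = \sum_(j < n) c j *: s j) ->
  exists r (e : 'I_r -> V), orthonormal_basis b D e.
Proof.
case=> n [s hs].
have [D0 Dlin] := hD.
have DD x y : x \in D -> y \in D -> x + y \in D.
  by move=> xD yD; rewrite -[x]scale1r Dlin.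
have DZ a x : x \in D -> a *: x \in D.
  by move=> xD; rewrite -[_ *: _]addr0 Dlin.
pose P r := `[< exists e : 'I_r -> V, (forall i, e i \in D) /\
   forall i j, b (e i) (e j) = (i == j)%:R >].
have exP : exists r, P r.
  by exists 0%N; apply/asboolP; exists (fun=> 0); split=> -[].
have maxP r : P r -> (r <= n)%N.
  move=> /asboolP[e [eD eo]]; apply: (@orthonormal_size n r s e) => // i.
  exact/hs/eD.
case: (ex_maxnP exP maxP) => r /asboolP[e [eD eo]] rmax.
exists r, e; split=> // v vD; apply/eqP; rewrite -subr_eq0; apply/eqP.
set w := v - _.
have wD : w \in D.
  rewrite /w -scaleN1r; apply/DD => //; apply/DZ.
  by apply: (big_ind (fun x => x \in D)) => [||i _]; [exact: D0|exact: DD|exact: DZ].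
have we i : b w (e i) = 0.
  rewrite psdBl// psd_suml// (bigD1 i)//= big1 ?addr0 => [|j ji].
    by rewrite psdZl// eo eqxx mulr1 subrr.
  by rewrite psdZl// eo (negPf ji) mulr0.
apply: b_definite => //; apply/eqP; apply: contraT => bw0.
have bw : 0 < b w w by rewrite lt_neqAle eq_sym bw0 psd_ge0.
pose w' := (Num.sqrt (b w w))^-1 *: w.
have w'e i : b w' (e i) = 0 by rewrite psdZl// we mulr0.
have w'1 : b w' w' = 1.
  rewrite psdZl// psdZr// mulrA -expr2 exprVn sqr_sqrtr ?mulVf// psd_ge0//.
suff /rmax : P r.+1 by rewrite ltnn.
apply/asboolP.
exists (fun i => if unlift ord_max i is Some j then e j else w'); split=> i.
  by case: unliftP => [j|] _ //; exact: DZ.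
move=> j; case: (unliftP ord_max i) => [i'|] ->; case: (unliftP ord_max j) => [j'|] ->.
- by rewrite eo (inj_eq lift_inj).
- by rewrite psdC// w'e eq_sym (negPf (neq_lift _ _)).
- by rewrite w'e (negPf (neq_lift _ _)).
- by rewrite eqxx w'1.
Qed.

End gram_schmidt.

Lemma ex_psd_projection (R : realType) (V : lmodType R) (b : V -> V -> R)
    (D : {pred V}) : psd_form b -> submod_closed D ->
  (forall v, v \in D -> b v v = 0 -> v = 0) ->
  (exists n (s : 'I_n -> V), forall v, v \in D ->
     exists c : 'I_n -> R, v = \sum_(j < n) c j *: s j) ->
  forall u, exists2 p, p \in D & forall z, z \in D -> b (u - p) z = 0.
Proof.
move=> hb hD bdef Dspan u.
have [r [e [eD eo ee]]] := ex_orthonormal_basis hb hD bdef Dspan.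
have [D0 Dlin] := hD.
have ueD : \sum_i b u (e i) *: e i \in D.
  apply: (big_ind (fun x => x \in D)) => [|x y xD yD|i _]; first exact: D0.
    by rewrite -[x]scale1r Dlin.
  by rewrite -[_ *: _]addr0 Dlin ?D0.
exists (\sum_i b u (e i) *: e i) => // z zD.
rewrite (psdC hb) (ee z zD) psd_suml// big1// => i _.
rewrite psdZl// psdBr// [b (e i) u]psdC//.
rewrite [b (e i) _]psdC// psd_suml// (bigD1 i)//= big1 ?addr0 => [|j ji].
  by rewrite psdZl// eo eqxx mulr1 subrr mulr0.
by rewrite psdZl// eo (negPf ji) mulr0.
Qed.

(** * Sharp quasi-optimality of oblique projections *)

Section quasi_optimality.
Variables (R : realType) (V : lmodType R) (a b : V -> V -> R) (D : {pred V}).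
Hypotheses (ha : psd_form a) (hb : psd_form b) (hD : submod_closed D).

(** Put [z = p - w] and [q = u - p], and let [A], [B], [Q] be the values of [a]
    on [(z, z)], [(z, q)], [(q, q)].  As [q] is [b]-orthogonal to [z], every
    combination satisfies
    [L * s ^+ 2 * A <= b (s *: z) (s *: z) <= b (s *: z + t *: q) (s *: z + t *: q)
    <= M * a (s *: z + t *: q) (s *: z + t *: q)],
    that is, the binary quadratic form with coefficients [(M - L) * A], [M * B],
    [M * Q] is nonnegative.  Its discriminant condition
    [M * B ^+ 2 <= (M - L) * (A * Q)] is symmetric in [A] and [Q]; exchanging
    them turns the bound for the projection into the one for the error. *)
Lemma quasi_optimality (L M : R) u p w : 0 <= L <= M ->
  (forall x, b x x <= M * a x x) -> (forall z, z \in D -> L * a z z <= b z z) ->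
  p \in D -> w \in D -> (forall z, z \in D -> b (u - p) z = 0) ->
  L * a (u - p) (u - p) <= M * a (u - w) (u - w).
Proof.
move=> /andP[L0 LM] bM Lb pD wD orth.
have [D0 Dlin] := hD.
set q := u - p in orth *; pose z := p - w.
have zD : z \in D by rewrite /z addrC -scaleN1r Dlin.
have -> : u - w = 1 *: z + 1 *: q.
  by rewrite !scale1r /z /q [RHS]addrC addrA subrK.
have key s t : L * (s ^+ 2 * a z z) <=
    M * (s ^+ 2 * a z z + (s * t * a z q) *+ 2 + t ^+ 2 * a q q).
  rewrite -psd_expand//; apply: le_trans (bM _).
  rewrite psd_expand// (psdC hb z) orth// mulr0 mul0rn addr0.
  apply: (@le_trans _ _ (s ^+ 2 * b z z)); last first.
    by rewrite lerDl mulr_ge0 ?sqr_ge0 ?psd_ge0.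
  by rewrite mulrCA ler_wpM2l ?sqr_ge0 ?Lb.
rewrite psd_expand//; move: key (psd_CauchySchwarz ha z q) (psd_ge0 ha z) (psd_ge0 ha q).
set A := a z z; set B := a z q; set Q := a q q => key CS A0 Q0.
have M0 : 0 <= M by apply: le_trans LM.
have [A_eq0|An0] := eqVneq A 0.
  have B0 : B = 0.
    apply/eqP; rewrite -sqrf_eq0; apply/eqP/le_anti.
    by rewrite sqr_ge0 andbT (le_trans CS)// A_eq0 mul0r.
  by rewrite A_eq0 B0 !(mul0r, mulr0, mul0rn, add0r, expr1n, mul1r) ler_wpM2r.
have Ap : 0 < A by rewrite lt_neqAle eq_sym An0.
have [Q_eq0|Qn0] := eqVneq Q 0.
  have B0 : B = 0.
    apply/eqP; rewrite -sqrf_eq0; apply/eqP/le_anti.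
    by rewrite sqr_ge0 andbT (le_trans CS)// Q_eq0 mulr0.
  by rewrite Q_eq0 B0 !(mulr0, mul0rn, addr0) mulr_ge0// mulr_ge0// sqr_ge0.
have Qp : 0 < Q by rewrite lt_neqAle eq_sym Qn0.
(* The direction [(Q, - B)] minimises the right-hand side of [key] for [s = Q]. *)
have disc : M * B ^+ 2 <= (M - L) * (A * Q).
  have := key Q (- B).
  rewrite -subr_ge0.
  have -> : M * (Q ^+ 2 * A + Q * - B * B *+ 2 + (- B) ^+ 2 * Q) -
    L * (Q ^+ 2 * A) = Q * ((M - L) * (A * Q) - M * B ^+ 2) by ring.
  by rewrite pmulr_rge0// subr_ge0.
rewrite -(ler_pM2l Ap) -subr_ge0.
have -> : A * (M * (1 ^+ 2 * A + 1 * 1 * B *+ 2 + 1 ^+ 2 * Q)) - A * (L * Q) =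
  ((M - L) * (A * Q) - M * B ^+ 2) + M * (A + B) ^+ 2 by ring.
by rewrite addr_ge0 ?subr_ge0// mulr_ge0// sqr_ge0.
Qed.

End quasi_optimality.

(** * Rayleigh quotients in finite dimension *)

Lemma inner_psd (R : realType) (V : preHilbertType R) :
  psd_form (inner : V -> V -> R).
Proof.
split; [exact: innerC|exact: innerZDl|by move=> x; rewrite inner_normE sqr_ge0].
Qed.

Section rayleigh.
Variables (R : realType) (V : preHilbertType R) (n : nat) (e : 'I_n -> V).
Hypothesis he : orthonormal_basis (inner : V -> V -> R) predT e.

Let hI := @inner_psd R V.

Lemma basis_norm i : `|e i| = 1.
Proof.
case: he => _ eo _; apply/eqP; rewrite -(@eqrXn2 _ 2)// expr1n.
by rewrite -inner_normE eo eqxx.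
Qed.

Lemma basis_coord_le v i : `|inner v (e i)| <= `|v|.
Proof. by apply: le_trans (CauchySchwarz_inner _ _) _; rewrite basis_norm mulr1. Qed.

Lemma finite_dim_bounded (W : normedModType R) (T : {linear V -> W}) :
  exists2 c : R, 0 < c & forall v, `|T v| <= c * `|v|.
Proof.
exists (1 + \sum_i `|T (e i)|); first by rewrite ltr_pwDl// sumr_ge0.
move=> v; rewrite mulrDl mul1r.
apply: (@le_trans _ _ (\sum_i `|T (e i)| * `|v|)); last first.
  by rewrite mulr_suml lerDr.
have [_ _ eb] := he; rewrite {1}(eb v)// linear_sum.
apply: le_trans (ler_norm_sum _ _ _) _; apply: ler_sum => i _.
by rewrite linearZ normrZ mulrC ler_wpM2l ?basis_coord_le.
Qed.

(** In an orthonormal basis the matrix of an injective endomorphism is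
    invertible, and the entries of its inverse bound the coordinates of [v] in
    terms of those of [T v]. *)
Lemma finite_dim_bounded_below (T : {linear V -> V}) :
  (forall v, T v = 0 -> v = 0) -> exists2 c : R, 0 < c & forall v, `|v| <= c * `|T v|.
Proof.
move=> Tinj; have [_ eo eb] := he.
pose A : 'M[R]_n := \matrix_(i, j) inner (T (e i)) (e j).
pose c v : 'rV[R]_n := \row_i inner v (e i).
have cT v : c (T v) = c v *m A.
  apply/rowP => j; rewrite !mxE {1}(eb v)// linear_sum (psd_suml hI).
  by apply: eq_bigr => i _; rewrite linearZ (psdZl hI) !mxE.
have c0 v : c v = 0 -> v = 0.
  move=> cv; rewrite (eb v)// big1// => i _.
  by have /rowP/(_ i) := cv; rewrite !mxE => ->; rewrite scale0r.
have Au : A \in unitmx.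
  rewrite -row_free_unit -kermx_eq0; apply/rowV0P => d /sub_kermxP dA.
  pose v := \sum_i d 0 i *: e i.
  have cv : c v = d.
    apply/rowP => j; rewrite mxE (psd_suml hI) (bigD1 j)//= big1 ?addr0 => [|i ij].
      by rewrite (psdZl hI) eo eqxx mulr1.
    by rewrite (psdZl hI) eo (negPf ij) mulr0.
  have /Tinj v0 : T v = 0 by apply: c0; rewrite cT cv.
  by apply/rowP => j; rewrite -cv v0 !mxE psd0l.
exists (1 + \sum_i \sum_j `|invmx A j i|).
  by rewrite ltr_pwDl// sumr_ge0// => i _; rewrite sumr_ge0.
move=> v; rewrite mulrDl mul1r.
apply: (@le_trans _ _ (\sum_i (\sum_j `|invmx A j i|) * `|T v|)); last first.
  by rewrite mulr_suml lerDr.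
rewrite {1}(eb v)//.
apply: le_trans (ler_norm_sum _ _ _) _; apply: ler_sum => i _.
rewrite normrZ basis_norm mulr1.
have : c v 0 i = (c (T v) *m invmx A) 0 i by rewrite cT mulmxK.
rewrite !mxE => ->; rewrite mulr_suml.
apply: le_trans (ler_norm_sum _ _ _) _; apply: ler_sum => j _.
by rewrite normrM mulrC mxE ler_wpM2l ?basis_coord_le.
Qed.

Variable T : {linear V -> V}.
Hypothesis T_sym : forall v w, inner (T v) w = inner (T w) v.

(** The supremum [a] of the Rayleigh quotient is an eigenvalue: otherwise
    [U = a - T] is injective, hence bounded below, and as it is positive
    semidefinite, Cauchy-Schwarz for its form gives
    [`|U v| ^+ 2 <= d * inner (U v) v] with [d] a bound of [U].  Then the form of
    [U] is coercive and the Rayleigh quotient stays away from [a]. *)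
Lemma rayleigh_le (M : R) : (forall l, eigenvalues T l -> l <= M) ->
  forall v, inner (T v) v <= M * `|v| ^+ 2.
Proof.
move=> TM v0; have [->|v0n] := eqVneq v0 0.
  by rewrite linear0 normr0 expr0n mulr0.
pose S := [set inner (T v) v / `|v| ^+ 2 | v in [set v | v != 0]].
have p2 (v : V) : v != 0 -> 0 < `|v| ^+ 2 by move=> vn; rewrite exprn_gt0 ?normr_gt0.
have S0 : S !=set0 by exists (inner (T v0) v0 / `|v0| ^+ 2), v0.
have [c cp Tc] := finite_dim_bounded T.
have Sub : has_ubound S.
  exists c => _ [v vn <-]; rewrite ler_pdivrMr ?p2//.
  apply: le_trans (ler_norm _) _; apply: le_trans (CauchySchwarz_inner _ _) _.
  by rewrite expr2 mulrA ler_wpM2r.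
pose a := sup S.
have Ta v : inner (T v) v <= a * `|v| ^+ 2.
  have [->|vn] := eqVneq v 0.
    by rewrite linear0 normr0 expr0n mulr0.
  by rewrite -ler_pdivrMr ?p2//; apply: ub_le_sup => //; exists v.
suff aE : eigenvalues T a.
  by apply: le_trans (Ta v0) _; rewrite ler_wpM2r ?sqr_ge0 ?TM.
apply: contrapT => aNE.
pose U : {linear V -> V} := (a \*: idfun \- T)%R.
have UE v : U v = a *: v - T v by [].
have Uinj v : U v = 0 -> v = 0.
  move=> Uv; apply/eqP; apply: contraT => vn; exfalso; apply: aNE.
  by exists v => //; apply/esym/eqP; rewrite -subr_eq0 -UE Uv.
have [k kp Uk] := finite_dim_bounded_below Uinj.
have [d dp Ud] := finite_dim_bounded U.
have Upsd : psd_form (fun v w => inner (U v) w).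
  split=> [v w|b v w z|v].
  - by rewrite !UE !(psdBl hI) !(psdZl hI) T_sym (innerC v).
  - by rewrite linearP innerZDl.
  - by rewrite UE (psdBl hI) (psdZl hI) inner_normE subr_ge0.
have Ulow v : `|v| ^+ 2 <= k ^+ 2 * d * inner (U v) v.
  have Uv2 : `|U v| ^+ 2 <= d * inner (U v) v.
    have [->|Uvn] := eqVneq (U v) 0.
      by rewrite (psd0l hI) normr0 expr0n mulr0.
    have CS : inner (U v) (U v) ^+ 2 <= inner (U v) v * inner (U (U v)) (U v).
      exact: (psd_CauchySchwarz Upsd).
    rewrite inner_normE in CS.
    rewrite -(ler_pM2r (p2 _ Uvn)) -expr2; apply: le_trans CS _.
    rewrite mulrAC mulrC; apply: ler_wpM2r; first exact: (psd_ge0 Upsd v).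
    apply: le_trans (ler_norm _) _; apply: le_trans (CauchySchwarz_inner _ _) _.
    by rewrite expr2 mulrA ler_wpM2r.
  apply: (@le_trans _ _ (k ^+ 2 * `|U v| ^+ 2)).
    by rewrite -exprMn ler_sqr ?nnegrE// mulr_ge0// ltW.
  by rewrite -mulrA ler_wpM2l ?sqr_ge0.
(* By [Ulow], [a] minus the inverse of [k ^+ 2 * d] is a smaller upper bound. *)
have q0 : 0 < k ^+ 2 * d by rewrite mulr_gt0 ?exprn_gt0.
suff : a <= a - (k ^+ 2 * d)^-1 by rewrite lerDl oppr_ge0 leNgt invr_gt0 q0.
apply: ge_sup => // _ [v vn <-]; rewrite ler_pdivrMr ?p2// mulrBl lerBrDr -lerBrDl.
rewrite ler_pdivrMl//; apply: le_trans (Ulow v) _.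
by rewrite UE (psdBl hI) (psdZl hI) inner_normE.
Qed.

End rayleigh.

Lemma rayleigh_ge (R : realType) (V : preHilbertType R) n (e : 'I_n -> V)
  (T : {linear V -> V}) (M : R) :
  orthonormal_basis (inner : V -> V -> R) predT e ->
  (forall v w, inner (T v) w = inner (T w) v) ->
  (forall l, eigenvalues T l -> M <= l) ->
  forall v, M * `|v| ^+ 2 <= inner (T v) v.
Proof.
move=> he Tsym TM v.
pose T' : {linear V -> V} := (\- T)%R.
have hI := inner_psd V.
have := @rayleigh_le R V n e he T' _ (- M) _ v.
rewrite mulNr -[T' v]/(- T v) (psdNl hI) lerN2; apply=> [x y|l [x xn Tx]].
  by rewrite -[T' x]/(- T x) -[T' y]/(- T y) !(psdNl hI) Tsym.
rewrite lerNr; apply: TM; exists x => //.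
by rewrite scaleNr -Tx opprK.
Qed.

(** * Riesz representation *)

Section duality.
Variables (R : realType).

Lemma norm_riesz (V : preHilbertType R) (v : V) : `|riesz v| = `|v|.
Proof.
apply/le_anti/andP; split.
  by apply: opnorm_le => // x; exact: CauchySchwarz_inner.
have [->|vn] := eqVneq v 0; first by rewrite normr0.
have vp : 0 < `|v| by rewrite normr_gt0.
rewrite -(ler_pM2r vp) -expr2 -inner_normE.
apply: le_trans (ler_norm _) _; exact: (le_dual_norm (riesz v) v).
Qed.

Lemma bounded_dual_subproof (V : normedModType R) (g : V -> R) (c : R) :
  linear (g : V -> R^o) -> (forall x, `|g x| <= c * `|x|) ->
  (g : V -> R^o) \in @continuous_functional R V.
Proof.
move=> gl gc; apply/asboolP; split=> //.
pose G := GRing.isLinear.Build R V R^o *:%R g gl.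
pose g' : {linear V -> R^o} := HB.pack g G.
apply: (@bounded_linear_continuous _ _ _ g').
apply/linear_boundedP; near=> r => x; apply: le_trans (gc x) _.
by rewrite ler_wpM2r//; near: r; apply: nbhs_pinfty_ge; rewrite num_real.
Unshelve. all: by end_near. Qed.

(** By the parallelogram law, almost maximising vectors [y n] of [g] on the unit
    ball form a Cauchy sequence; its limit [l] maximises [g] on the ball.
    Maximality makes [l] orthogonal to the kernel of [g], so that [g] is a
    multiple of [inner l]. *)
Lemma riesz_surjective (V : hilbertType R) (g : dual V) : exists v, riesz v = g.
Proof.
have [->|gn] := eqVneq g 0; first by exists 0; rewrite linear0.
have Np : 0 < `|g| by rewrite normr_gt0.
set N := `|g| in Np.
have hI := inner_psd V.
have /choice[y hy] : forall n, exists y : V, `|y| <= 1 /\ N - n.+1%:R^-1 <= g y.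
  move=> n.
  have S : has_sup [set `|g x| / `|x| | x in [set x | x != 0]].
    apply: contrapT => /sup_out; move: Np.
    by rewrite /N /Num.Def.normr/= /dual_norm /opnorm => + h; rewrite h ltxx.
  have [|_ [x /= xn <-] hx] := sup_adherent (eps := n.+1%:R^-1) _ S.
    by rewrite invr_gt0.
  exists ((Num.sg (g x) / `|x|) *: x); split.
    rewrite normrZ normrM normfV normr_id -mulrA mulVf ?normr_eq0// mulr1.
    by rewrite normr_sg; case: (_ != 0).
  rewrite linearZ/= -[_ *: _]/(_ * _) mulrAC.
  by rewrite -normrEsg ltW.
have yle n : `|y n| <= 1 by case: (hy n).
have gy n : N - n.+1%:R^-1 <= g (y n) by case: (hy n).
have gle v : g v <= N * `|v|.
  by apply: le_trans (ler_norm _) _; exact: le_dual_norm.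
(* Both vectors nearly maximise [g] on the unit ball, so their sum has norm almost
   2 and the parallelogram law makes their difference small. *)
have ycauchy n m : (n <= m)%N -> `|y n - y m| ^+ 2 <= 8 / N * n.+1%:R^-1.
  move=> nm; set d : R := n.+1%:R^-1.
  have dm : m.+1%:R^-1 <= d by rewrite lef_pV2 ?posrE// ler_nat ltnS.
  have d0 : 0 < d by rewrite invr_gt0.
  have sumge : 2 - 2 * d / N <= `|y n + y m|.
    rewrite -(ler_pM2l Np); apply: le_trans (gle _).
    rewrite linearD/=.
    have -> : N * (2 - 2 * d / N) = 2 * N - 2 * d.
      by field; rewrite gt_eqF.
    apply: le_trans (lerD (gy n) (gy m)); rewrite -/d.
    move: dm; set d' := _^-1 => ?; lra.
  have par : `|y n - y m| ^+ 2 + `|y n + y m| ^+ 2 =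
      2 * `|y n| ^+ 2 + 2 * `|y m| ^+ 2.
    rewrite -!inner_normE (psdBl hI) (psdDl hI) !(psdBr hI) !(psdDr hI).
    by rewrite (innerC (y m)); ring.
  have sq1 k : `|y k| ^+ 2 <= 1 by rewrite expr_le1.
  have s0 : 0 <= `|y n + y m| by [].
  have dN : 0 <= d / N by rewrite divr_ge0// ltW.
  have -> : 8 / N * d = 8 * (d / N) by ring.
  have {}sumge : 2 - 2 * (d / N) <= `|y n + y m| by rewrite mulrA.
  have Ple : `|y n - y m| ^+ 2 <= 4 - `|y n + y m| ^+ 2.
    by have := sq1 n; have := sq1 m; lra.
  apply: le_trans Ple _; have [t1|t1] := leP 1 (d / N).
    by rewrite lerBlDr; apply: ler_wpDr; [exact: sqr_ge0|lra].
  have : (2 - 2 * (d / N)) ^+ 2 <= `|y n + y m| ^+ 2.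
    by rewrite ler_sqr ?nnegrE//; lra.
  by have := sqr_ge0 (d / N); rewrite sqrrB; lra.
have /cvg_ex[l yl] : cvg (y @ \oo).
  apply: cauchy_cvg; apply: cauchy_exP => e e0.
  pose n := Num.bound (8 / N / e ^+ 2).
  have e2 : 0 < e ^+ 2 by rewrite exprn_gt0.
  have nP : 8 / N * n.+1%:R^-1 < e ^+ 2.
    rewrite ltr_pdivrMr// [ltRHS]mulrC -ltr_pdivrMr//.
    have : 8 / N / e ^+ 2 < n%:R by apply: archi_boundP; rewrite !divr_ge0// ltW.
    by move=> h; apply: lt_trans h _; rewrite ltr_nat.
  exists (y n); exists n => // m /= nm; rewrite -ball_normE /=.
  rewrite -(@ltr_pXn2r _ 2)// ?nnegrE// ?ltW//.
  exact: le_lt_trans (ycauchy _ _ nm) nP.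
have gl : N <= g l.
  have gyl : (g \o y) @ \oo --> g l.
    apply: continuous_cvg => //; exact: dual_continuous.
  apply/ler_addgt0Pr => e e0; rewrite -lerBlDr.
  apply: (cvgr_to_ge gyl).
  exists (Num.bound e^-1) => // n /= nm; apply: le_trans (gy n).
  rewrite lerB// invf_ple ?posrE//.
  apply: ltW; apply: lt_le_trans (archi_boundP _) _; first by rewrite invr_ge0 ltW.
  by rewrite ler_nat ltnW.
have ll : `|l| <= 1.
  have nyl : (Num.norm \o y) @ \oo --> `|l|.
    exact: (@cvg_norm _ _ _ _ _ y).
  apply: (cvgr_to_le nyl).
  by exists 0%N => // n _ /=.
(* [g] takes the value [g l >= N] at every [l + t *: w], hence their norm is at
   least 1 for all [t]. *)
have ker w : g w = 0 -> inner l w = 0.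
  move=> gw; set B := inner l w; set C := `|w| ^+ 2.
  have C0 : 0 <= C by rewrite sqr_ge0.
  have H t : 0 <= (t * B) *+ 2 + t ^+ 2 * C.
    have : 1 <= `|1 *: l + t *: w|.
      rewrite -(ler_pM2l Np) mulr1; apply: le_trans (gle _).
      by rewrite linearP/= linearZ/= gw scaler0 addr0 scale1r.
    rewrite -(@ler_pXn2r _ 2)// ?nnegrE// expr1n -inner_normE (psd_expand hI).
    rewrite !inner_normE mul1r expr1n mul1r -/B -/C -addrA => h.
    have : `|l| ^+ 2 <= 1 by rewrite expr_le1.
    by move: h => *; lra.
  apply/eqP; apply: contraT => Bn.
  have := H (- B / (C + 1)).
  have -> : (- B / (C + 1) * B) *+ 2 + (- B / (C + 1)) ^+ 2 * C =
     - ((B / (C + 1)) ^+ 2 * (C + 2)).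
    by field; rewrite gt_eqF// ltr_wpDl.
  rewrite oppr_ge0 leNgt mulr_gt0// ?ltr_wpDl//.
  by rewrite exprn_even_gt0//= mulf_neq0// invr_neq0// gt_eqF// ltr_wpDl.
have gl0 : g l != 0 by rewrite gt_eqF// (lt_le_trans Np).
have ln0 : inner l l != 0.
  rewrite inner_normE sqrf_eq0 normr_eq0; apply: contra_neq gl0 => ->.
  exact: linear0.
exists ((g l / inner l l) *: l); apply/val_inj/funext => z /=.
rewrite (psdZl hI).
have : inner l (z - (g z / g l) *: l) = 0.
  apply: ker; rewrite linearB/= linearZ/= -[_ *: _]/(_ * _) divfK// subrr//.
rewrite (psdBr hI) (psdZr hI) => /eqP; rewrite subr_eq0 => /eqP ->.
by field; rewrite gl0 ln0.
Qed.

End duality.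
Section dual_hilbert.
Variables (R : realType) (V : hilbertType R).

Definition riesz_inv (g : dual V) : V := xget 0 [set v | riesz v = g].

Lemma riesz_invK : cancel riesz_inv (@riesz R V).
Proof.
move=> g; rewrite /riesz_inv; have [v vg] := riesz_surjective g.
by case: xgetP => [w _|/(_ v)] //.
Qed.

Lemma riesz_inv_linear : linear riesz_inv.
Proof.
move=> a g h; apply/eqP; rewrite -subr_eq0 -normr_eq0 -norm_riesz.
by rewrite linearB linearP/= !riesz_invK subrr normr0.
Qed.

Definition dual_dot (g h : dual V) : R := inner (riesz_inv g) (riesz_inv h).

Lemma dual_dot_psd : psd_form dual_dot.
Proof. exact: psd_comp riesz_inv_linear (inner_psd V). Qed.

Lemma dual_dotE g : dual_dot g g = `|g| ^+ 2.
Proof. by rewrite /dual_dot inner_normE -norm_riesz riesz_invK. Qed.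

End dual_hilbert.

(** * Functionals on finite dimensional subspaces *)

Section restriction.
Variables (R : realType) (V : preHilbertType R) (W : fdsubspace V).

Lemma restr_subproof (g : dual V) :
  ((fun w : W => g (fd_val w)) : W -> R^o) \in @continuous_functional R W.
Proof.
apply: (@bounded_dual_subproof _ _ _ `|g|) => [a x y|x].
  by rewrite linearP.
exact: le_dual_norm g (fd_val x).
Qed.

Definition restr (g : dual V) : dual W := Dual (restr_subproof g).

Lemma restr_linear : linear restr.
Proof. by move=> a g h; apply/val_inj. Qed.

Lemma restr_norm g : `|restr g| <= `|g|.
Proof. by apply: opnorm_le => // x; exact: (le_dual_norm g (fd_val x)). Qed.

Lemma fd_orthonormal_basis :
  exists r (e : 'I_r -> W), orthonormal_basis (inner : W -> W -> R) predT e.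
Proof.
have hI := inner_psd V.
have [v _ /eqP|r [e [eD eo ee]]] := ex_orthonormal_basis hI (fd_submod W) _ (fd_span W).
  by rewrite inner_normE sqrf_eq0 normr_eq0 => /eqP.
exists r, (fun i => FDSort (eD i)); split=> // v _.
apply/val_inj; rewrite /= {1}(ee _ (fd_valP v)).
by rewrite (big_morph (@fd_val R V W) (id1 := 0) (op1 := +%R)).
Qed.

(** A finite dimensional subspace comes without a completeness structure; an
    orthonormal basis gives the representing vector explicitly. *)
Lemma fd_riesz_surjective (h : dual W) : exists v : W, riesz v = h.
Proof.
have hI := inner_psd W.
have [r [e [_ eo ee]]] := fd_orthonormal_basis.
exists (\sum_i h (e i) *: e i); apply/val_inj/funext => w /=.
rewrite (psd_suml hI) {2}(ee w)// linear_sum; apply: eq_bigr => i _.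
by rewrite (psdZl hI) linearZ /= innerC mulrC.
Qed.

End restriction.

(** * The norm induced by the preconditioner *)

Section preconditioner.
Variables (R : realType) (V : preHilbertType R) (W : fdsubspace V).
Variables (K : {linear dual W -> W}) (Kinv : {linear W -> dual W}).
Hypothesis hK : bounded_inverse K Kinv.
Hypothesis hKadj : forall g h : dual W, g (K h) = h (K g).
Hypothesis hKsp : is_scalar_product (precond_inner Kinv).

Definition precond_form (g h : dual W) : R := g (K h).

Lemma precond_inner_psd : psd_form (precond_inner Kinv).
Proof.
case: hKsp => sC sP s0; split=> // x; have [->|/s0/ltW//] := eqVneq x 0.
by rewrite /precond_inner !linear0.
Qed.

Lemma precond_formE (h : dual W) y : h y = precond_inner Kinv (K h) y.
Proof. by case: hK => _ _ KK _; rewrite /precond_inner KK. Qed.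

Lemma precond_form_psd : psd_form precond_form.
Proof.
split=> [g h|a g h l //|h]; first exact: hKadj.
by rewrite /precond_form (precond_formE h (K h)); exact: psd_ge0 precond_inner_psd _.
Qed.

(** As [h y] is the [K]-induced scalar product of [K h] and [y], the supremum is
    given by Cauchy-Schwarz and reached at [y = K h].  If [K h = 0] then [h = 0],
    and the supremum is 0 even when it runs over the empty set. *)
Lemma sup_precond (h : dual W) :
  sup [set `|h y| ^+ 2 / precond_inner Kinv y y | y in [set y : W | y != 0]] =
  precond_form h h.
Proof.
set S := (X in sup X); have [_ _ s0] := hKsp.
have ub : ubound S (precond_form h h).
  move=> _ [y /= yn <-]; rewrite ler_pdivrMr ?s0// real_normK ?num_real//.
  rewrite (precond_formE h y) /precond_form (precond_formE h (K h)).
  exact: psd_CauchySchwarz precond_inner_psd _ _.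
have [Kh0|Khn] := eqVneq (K h) 0.
  have h0 : h = 0 by have [_ _ KK _] := hK; rewrite -(KK h) Kh0 linear0.
  apply/le_anti/andP; split.
    have [S0|S0] := eqVneq S set0.
      by rewrite S0 sup0 (psd_ge0 precond_form_psd h).
    by apply: ge_sup => //; exact/set0P.
  rewrite {1}/precond_form Kh0 linear0; have [[[s Ss] Sub]|/sup_out->//] := pselect (has_sup S).
  apply: le_trans (ub_le_sup Sub Ss); case: Ss => y /= yn <-.
  by rewrite divr_ge0 ?sqr_ge0 ?(ltW (s0 _ yn)).
apply/le_anti/andP; split.
  by apply: ge_sup => //; eexists; exists (K h).
apply: ub_le_sup; first by eexists; exact: ub.
exists (K h) => //=; rewrite real_normK ?num_real// -(precond_formE h (K h)).
by rewrite /precond_form expr2 mulfK// (precond_formE h (K h)) gt_eqF// s0.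
Qed.

Let T : {linear W -> W} := K \o @riesz R W.

Lemma precond_riesz v : precond_form (riesz v) (riesz v) = inner (T v) v.
Proof. by rewrite innerC. Qed.

Let T_sym v w : inner (T v) w = inner (T w) v.
Proof. by rewrite !(innerC (T _)); exact: (hKadj (riesz w) (riesz v)). Qed.

Lemma precond_form_le (M : R) (h : dual W) :
  (forall l, eigenvalues (K \o @riesz R W) l -> l <= M) ->
  precond_form h h <= M * `|h| ^+ 2.
Proof.
move=> TM; have [v <-] := fd_riesz_surjective h.
have [r [e he]] := fd_orthonormal_basis W.
by rewrite precond_riesz norm_riesz; have := rayleigh_le he T_sym TM v.
Qed.

Lemma precond_form_ge (M : R) (h : dual W) :
  (forall l, eigenvalues (K \o @riesz R W) l -> M <= l) ->
  M * `|h| ^+ 2 <= precond_form h h.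
Proof.
move=> TM; have [v <-] := fd_riesz_surjective h.
have [r [e he]] := fd_orthonormal_basis W.
by rewrite precond_riesz norm_riesz; have := rayleigh_ge he T_sym TM v.
Qed.

(** If [K (riesz v) = l *: v] then [riesz v = l *: Kinv v], so [l] is bounded
    below by the inverse of a bound of [Kinv]: a positive bound, so that [mu]
    will be positive. *)
Lemma precond_eigenvalues_bounded :
  exists2 C : R, 0 < C & forall l, eigenvalues (K \o @riesz R W) l ->
    C^-1 <= l <= C.
Proof.
have [r [e he]] := fd_orthonormal_basis W.
have [c cp Tc] := finite_dim_bounded he T.
have [d dp Kd] := finite_dim_bounded he Kinv.
exists (c + d); first exact: addr_gt0.
move=> l [v vn Tv]; have vp : 0 < `|v| by rewrite normr_gt0.
have l0 : 0 <= l.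
  have : 0 <= inner (T v) v by rewrite -precond_riesz (psd_ge0 precond_form_psd).
  rewrite [T v]Tv (psdZl (inner_psd W)) inner_normE pmulr_lge0// exprn_gt0//.
apply/andP; split.
  apply: (@le_trans _ _ d^-1).
    by rewrite lef_pV2 ?posrE ?addr_gt0// lerDr ltW.
  rewrite -(ler_pM2r vp) ler_pdivrMl//.
  have KvE : l *: Kinv v = riesz v.
    by case: hK => _ _ KK _; rewrite -linearZ -Tv /= KK.
  have vE : `|v| = l * `|Kinv v| by rewrite -norm_riesz -KvE normrZ ger0_norm.
  by rewrite {1}vE mulrCA ler_wpM2l.
apply: (@le_trans _ _ c); last by rewrite lerDl ltW.
by rewrite -(ler_pM2r vp) -{1}(ger0_norm l0) -normrZ -Tv; exact: Tc.
Qed.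

End preconditioner.

(** * Extreme eigenvalues as real numbers *)

Section extremal_eigenvalues.
Variables (R : realType) (k : nat) (S : 'I_k -> set R).

(** [fine] discards infinite values, so its use in the constants has to be
    justified: on a trivial space the extended supremum is [-oo], but the
    initial value 1 keeps the maximum finite. *)
Lemma fine_bigmaxe : (forall i, exists C, ubound (S i) C) ->
  let M := fine (\big[maxe/1%E]_(i < k) ereal_sup (EFin @` S i)) in
  1 <= M /\ forall i l, S i l -> l <= M.
Proof.
move=> /choice[C SC] /=; set B := (X in fine X).
have B1 : (1 <= B)%E by apply: bigmax_ge_id.
have Bfin : B \is a fin_num.
  rewrite fin_numE gt_eqF ?(lt_le_trans _ B1) ?ltNyr//= lt_eqF//.
  apply: bigmax_lt => [|i _]; first exact: ltry.
  apply: (@le_lt_trans _ _ (C i)%:E); last exact: ltry.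
  by apply: ge_ereal_sup => _ [l Sl <-]; rewrite lee_fin; exact: SC.
split=> [|i l Sl]; rewrite -lee_fin fineK//.
apply: le_trans (le_bigmax _ _ i); apply: ereal_sup_ubound.
by exists l.
Qed.

Lemma fine_bigmine : (exists2 c, 0 < c & forall i, lbound (S i) c) ->
  let mu := fine (\big[mine/1%E]_(i < k) ereal_inf (EFin @` S i)) in
  [/\ 0 < mu, mu <= 1 & forall i l, S i l -> mu <= l].
Proof.
move=> [c cp Sc] /=; set B := (X in fine X).
have B1 : (B <= 1)%E by apply: bigmin_le_id.
have Bc : ((Num.min c 1)%:E <= B)%E.
  apply: le_bigmin => [|i _]; first by rewrite lee_fin ge_min lexx orbT.
  apply: le_ereal_inf_tmp => _ [l Sl <-]; rewrite lee_fin ge_min.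
  by rewrite (Sc i l Sl).
have Bfin : B \is a fin_num.
  by rewrite fin_numE gt_eqF ?(lt_le_trans _ Bc) ?ltNyr//= lt_eqF// (le_lt_trans B1) ?ltry.
split; rewrite -?lte_fin -?lee_fin ?fineK//.
  by apply: lt_le_trans Bc; rewrite lte_fin lt_min cp ltr01.
move=> i l Sl; rewrite -lee_fin fineK//.
apply: (@le_trans _ _ (ereal_inf (EFin @` S i))); first exact: bigmin_le.
apply: ereal_inf_lbound.
by exists l.
Qed.

End extremal_eigenvalues.

(** * The least-squares form on the dual product *)

Lemma sum_widen_split (R : realType) (k m : nat) (hkm : (k <= m)%N) (F : 'I_m -> R) :
  \sum_(i < m) F i =
  \sum_(i < k) F (widen_ord hkm i) + \sum_(i < m | (k <= i)%N) F i.
Proof.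
rewrite (bigID (fun i : 'I_m => (k <= i)%N)) addrC /=; congr (_ + _).
by rewrite -(big_ord_narrow hkm); apply: eq_bigl => i; rewrite ltnNge.
Qed.

Lemma ler_mul_inf (R : realType) (c x : R) (S : set R) : 0 <= c -> S !=set0 ->
  (forall s, S s -> x <= c * s) -> x <= c * inf S.
Proof.
move=> c0 S0 Sx; have [c_eq0|cn] := eqVneq c 0.
  by have [s /Sx] := S0; rewrite c_eq0 !mul0r.
have cp : 0 < c by rewrite lt_neqAle eq_sym cn.
rewrite -ler_pdivrMl//; apply: lb_le_inf => // s /Sx.
by rewrite ler_pdivrMl.
Qed.

Lemma l2norm_sqr (R : realType) (I : finType) (V : I -> normedModType R)
  (x : l2prod V) : `|x| ^+ 2 = \sum_i `|x i| ^+ 2.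
Proof. by rewrite sqr_sqrtr// sumr_ge0// => i _; exact: sqr_ge0. Qed.

Section least_squares_forms.
Variables (R : realType) (k m : nat) (hkm : (k <= m)%N).
Variables (X : hilbertType R) (Y : 'I_m -> hilbertType R).
Variable Yd : forall i : 'I_k, fdsubspace (Y (widen_ord hkm i)).
Local Notation wid := (widen_ord hkm).
Local Notation Y' := (l2prod (fun i => dual (Y i))).

Definition energy (g h : Y') : R := \sum_i dual_dot (g i) (h i).

Lemma energy_psd : psd_form energy.
Proof.
apply: (psd_sum (V := Y') (P := xpredT) (b := fun i g h => dual_dot (g i) (h i))).
by move=> i _; apply: (psd_comp (F := fun g : Y' => g i)) (@dual_dot_psd R (Y i)).
Qed.

Lemma energyE g : energy g g = `|g| ^+ 2.
Proof. by rewrite l2norm_sqr; apply: eq_bigr => i _; rewrite dual_dotE. Qed.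

(** The square of the norm of [g] as a functional on the discrete test space, in
    the form in which it compares with the least-squares form componentwise. *)
Definition discrete_norm_sqr (g : Y') : R :=
  \sum_(i < k) `|restr (Yd i) (g (wid i))| ^+ 2 + \sum_(i < m | (k <= i)%N) `|g i| ^+ 2.

Lemma discrete_norm_sqr_le (g : Y') : discrete_norm_sqr g <= `|g| ^+ 2.
Proof.
rewrite l2norm_sqr (sum_widen_split hkm) lerD2r; apply: ler_sum => i _.
by rewrite ler_sqr ?nnegrE// restr_norm.
Qed.

Lemma discrete_norm_sqr_ge0 (g : Y') : 0 <= discrete_norm_sqr g.
Proof. by rewrite addr_ge0// sumr_ge0// => i _; exact: sqr_ge0. Qed.

Lemma pairing_le (g : Y') (y : l2prod Y) : prod_subspace Yd y ->
  `|pairing g y| <= Num.sqrt (discrete_norm_sqr g) * `|y|.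
Proof.
move=> Dy.
(* The test spaces are indexed by ['I_k]; [b] carries their norms over to ['I_m],
   so that one Cauchy-Schwarz inequality over ['I_m] suffices. *)
pose b (i : 'I_m) := if insub (i : nat) is Some j then
  `|restr (Yd j) (g (wid j))| else `|g i|.
have bE : discrete_norm_sqr g = \sum_i b i ^+ 2.
  rewrite (sum_widen_split hkm); congr (_ + _).
    apply: eq_bigr => j _; congr (_ ^+ 2).
    by rewrite /b /= (valK j).
  by apply: eq_bigr => i ki; rewrite /b insubF// ltnNge ki.
have b0 i : 0 <= b i by rewrite /b; case: insubP.
have gb i : `|g i (y i)| <= b i * `|y i|.
  rewrite /b; case: insubP => [j _ ji|_]; last exact: le_dual_norm.
  have {ji} -> : i = wid j by apply: val_inj; rewrite /= -ji.
  exact: (le_dual_norm (restr (Yd j) (g (wid j))) (FDSort (Dy j))).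
rewrite -(@ler_pXn2r _ 2)// ?nnegrE ?mulr_ge0 ?sqrtr_ge0//.
rewrite exprMn sqr_sqrtr ?discrete_norm_sqr_ge0// bE l2norm_sqr.
apply: le_trans (CauchySchwarz_sum _ _).
rewrite ler_sqr ?nnegrE ?sumr_ge0// => [|i _]; last by rewrite mulr_ge0.
by apply: le_trans (ler_norm_sum _ _ _) _; apply: ler_sum => i _.
Qed.

Lemma infsup_le (G : {linear X -> Y'}) (Xd : fdsubspace X) z : z \in Xd ->
  0 < infsup G Xd Yd ->
  infsup G Xd Yd ^+ 2 * `|G z| ^+ 2 <= discrete_norm_sqr (G z).
Proof.
move=> zX gam0.
have [->|Gz0] := eqVneq (G z) 0.
  by rewrite normr0 expr0n mulr0 discrete_norm_sqr_ge0.
have Gzp : 0 < `|G z| by rewrite normr_gt0.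
have gz : infsup G Xd Yd * `|G z| <= Num.sqrt (discrete_norm_sqr (G z)).
  rewrite -ler_pdivlMr//; apply: (@le_trans _ _
   (sup [set `|pairing (G z) y| / `|y| |
       y in [set y | prod_subspace Yd y /\ y != 0]] / `|G z|)).
    apply: ge_inf; last by exists z.
    exists 0 => _ [x _ <-]; rewrite divr_ge0//; set S := (X in sup X).
    have [[[s Ss] Sub]|/sup_out->//] := pselect (has_sup S).
    apply: le_trans (ub_le_sup Sub Ss); case: Ss => y _ <-.
    by rewrite divr_ge0.
  rewrite ler_pM2r ?invr_gt0//; set S := (X in sup X).
  have [S0|S0] := eqVneq S set0; first by rewrite S0 sup0 sqrtr_ge0.
  apply: ge_sup; first exact/set0P.
  by move=> _ [y [Dy yn] <-]; rewrite ler_pdivrMr ?normr_gt0// pairing_le.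
rewrite -exprMn -[leRHS]sqr_sqrtr ?discrete_norm_sqr_ge0//.
by rewrite ler_sqr ?nnegrE ?sqrtr_ge0// mulr_ge0// ltW.
Qed.

Variable K : forall i : 'I_k, {linear dual (Yd i) -> Yd i}.

Definition ls_form (g h : Y') : R :=
  \sum_(i < k) precond_form (K i) (restr (Yd i) (g (wid i))) (restr (Yd i) (h (wid i)))
  + \sum_(i < m | (k <= i)%N) dual_dot (g i) (h i).

Variable Kinv : forall i : 'I_k, {linear Yd i -> dual (Yd i)}.
Hypothesis hK : forall i : 'I_k, bounded_inverse (K i) (Kinv i).
Hypothesis hKadj : forall (i : 'I_k) (g h : dual (Yd i)), g (K i h) = h (K i g).
Hypothesis hKsp : forall i : 'I_k, is_scalar_product (precond_inner (Kinv i)).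

Lemma ls_form_psd : psd_form ls_form.
Proof.
apply: (psdD (V := Y')).
  apply: (psd_sum (V := Y') (P := xpredT) (b := fun i g h => precond_form (K i)
    (restr (Yd i) (g (wid i))) (restr (Yd i) (h (wid i))))) => i _.
  apply: (psd_comp (F := fun g : Y' => restr (Yd i) (g (wid i)))).
    by move=> a g h; rewrite -restr_linear.
  exact: precond_form_psd (hK i) (hKadj (i := i)) (hKsp i).
apply: (psd_sum (V := Y') (P := fun i : 'I_m => (k <= i)%N)
  (b := fun i g h => dual_dot (g i) (h i))).
by move=> i _; apply: (psd_comp (F := fun g : Y' => g i)) (@dual_dot_psd R (Y i)).
Qed.

Lemma ls_functionalE (G : {linear X -> Y'}) f z :
  ls_functional G Kinv f z = 2^-1 * ls_form (G z - f) (G z - f).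
Proof.
congr (_ * (_ + _)); apply: eq_bigr => i _; last by rewrite dual_dotE.
rewrite -(sup_precond (hK i) (hKadj (i := i)) (hKsp i)).
by congr sup.
Qed.

Lemma eig_max_ge : 1 <= eig_max K /\ forall i l,
  eigenvalues (K i \o @riesz R (Yd i)) l -> l <= eig_max K.
Proof.
apply: (fine_bigmaxe (S := fun i => eigenvalues (K i \o @riesz R (Yd i)))) => i.
have [C _ KC] := precond_eigenvalues_bounded (hK i) (hKadj (i := i)) (hKsp i).
by exists C => l /KC/andP[].
Qed.

Lemma eig_min_le : [/\ 0 < eig_min K, eig_min K <= 1 & forall i l,
  eigenvalues (K i \o @riesz R (Yd i)) l -> eig_min K <= l].
Proof.
apply: (fine_bigmine (S := fun i => eigenvalues (K i \o @riesz R (Yd i)))).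
have /choice[C hC] : forall i, exists C : R, 0 < C /\
    lbound (eigenvalues (K i \o @riesz R (Yd i))) C^-1.
  move=> i.
  have [C C0 KC] := precond_eigenvalues_bounded (hK i) (hKadj (i := i)) (hKsp i).
  by exists C; split=> // l /KC/andP[].
have S0 : 0 <= \sum_i C i by apply: sumr_ge0 => i _; case: (hC i) => /ltW.
exists (1 + \sum_i C i)^-1; first by rewrite invr_gt0 ltr_pwDl.
move=> i l Sl; have [Ci0 Cl] := hC i; apply: le_trans (Cl _ Sl).
rewrite lef_pV2 ?posrE// ?ltr_pwDl//.
rewrite (bigD1 i)//= addrCA lerDl addr_ge0// sumr_ge0// => j _.
by case: (hC j) => /ltW.
Qed.

Lemma ls_form_le g : ls_form g g <= eig_max K * discrete_norm_sqr g.
Proof.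
have [M1 MS] := eig_max_ge; rewrite mulrDr !mulr_sumr.
apply: lerD; apply: ler_sum => i _.
  by apply: precond_form_le => [|l]; [exact: hKadj|exact: MS].
by rewrite dual_dotE ler_peMl ?sqr_ge0.
Qed.

Lemma ls_form_ge g : eig_min K * discrete_norm_sqr g <= ls_form g g.
Proof.
have [mu0 mu1 muS] := eig_min_le; rewrite mulrDr !mulr_sumr.
apply: lerD; apply: ler_sum => i _.
  by apply: precond_form_ge => [|l]; [exact: hKadj|exact: muS].
by rewrite dual_dotE ler_piMl ?sqr_ge0.
Qed.

End least_squares_forms.

(** * The error estimate *)

Theorem theorem3p6 (R : realType) (k m : nat) (hkm : (k <= m)%N) (hm : (1 <= m)%N)
  (X : hilbertType R) (Y : 'I_m -> hilbertType R)
  (G : {linear X -> l2prod (fun i => dual (Y i))})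
  (Ginv : {linear l2prod (fun i => dual (Y i)) -> X})
  (hG : bounded_inverse G Ginv)
  (Xd : fdsubspace X)
  (Yd : forall i : 'I_k, fdsubspace (Y (widen_ord hkm i)))
  (K : forall i : 'I_k, {linear dual (Yd i) -> Yd i})
  (Kinv : forall i : 'I_k, {linear Yd i -> dual (Yd i)})
  (hK : forall i : 'I_k, bounded_inverse (K i) (Kinv i))
  (hKadj : forall (i : 'I_k) (g h : dual (Yd i)), g (K i h) = h (K i g))
  (hKsp : forall i : 'I_k, is_scalar_product (precond_inner (Kinv i)))
  (hgamma : 0 < infsup G Xd Yd)
  (f : l2prod (fun i => dual (Y i))) :
  let gamma := infsup G Xd Yd in
  let M := eig_max K in
  let mu := eig_min K in
  let u := Ginv f in
  exists ud : X,
    [/\ argmin [set` Xd] (ls_functional G Kinv f) = [set ud],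
        `|G (u - ud)| <= Num.sqrt M / (gamma * Num.sqrt mu)
                         * inf [set `|G (u - w)| | w in [set` Xd]]
      & `|u - ud| <= Num.sqrt (M / mu) * (opnorm G * opnorm Ginv / gamma)
                     * inf [set `|u - w| | w in [set` Xd]]].
Proof.
move=> gamma M mu u.
have [Gc Gic GK GiK] := hG.
have [M1 _] := eig_max_ge hK hKadj hKsp.
have [mu0 mu1 _] := eig_min_le hK hKadj hKsp.
have M0 : 0 < M by apply: lt_le_trans M1.
pose a x y := energy (G x) (G y).
pose b x y := ls_form K (G x) (G y).
have ha : psd_form a := psd_comp (linearP G) (@energy_psd R m Y).
have hb : psd_form b := psd_comp (linearP G) (ls_form_psd hK hKadj hKsp).
have aE x : a x x = `|G x| ^+ 2 by exact: energyE.
pose L := gamma ^+ 2 * mu.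
have L0 : 0 < L by rewrite mulr_gt0// exprn_gt0.
have bM x : b x x <= M * a x x.
  rewrite aE; apply: le_trans (ls_form_le hK hKadj hKsp _) _.
  by rewrite ler_wpM2l ?(ltW M0)// discrete_norm_sqr_le.
have Lb z : z \in Xd -> L * a z z <= b z z.
  move=> zX; rewrite aE; apply: le_trans (ls_form_ge hK hKadj hKsp _).
  by rewrite /L mulrAC mulrC ler_wpM2l ?(ltW mu0)// infsup_le.
(* [gamma > 0] excludes an infimum over the empty set, so some [z] has [G z != 0]. *)
have LM : L <= M.
  have [[_ [z [zX Gz0] _]]|S0] := pselect ([set sup [set `|pairing (G z) y| / `|y| |
                 y in [set y | prod_subspace Yd y /\ y != 0]] / `|G z| |
        z in [set z | z \in Xd /\ G z != 0]] !=set0).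
    have az : 0 < a z z by rewrite aE exprn_gt0 ?normr_gt0.
    by rewrite -(ler_pM2r az); apply: le_trans (Lb z zX) (bM z).
  by move: hgamma; rewrite /infsup; move/nonemptyPn: S0 => ->; rewrite inf0 ltxx.
have Gu : G u = f by exact: GiK.
have bdef z : z \in Xd -> b z z = 0 -> z = 0.
  move=> zX bz; rewrite -(GK z); suff -> : G z = 0 by rewrite linear0.
  apply/eqP; rewrite -normr_eq0 -sqrf_eq0 -aE eq_le (psd_ge0 ha) andbT.
  by rewrite -(pmulr_rle0 _ L0) -bz Lb.
have [ud udX orth] := ex_psd_projection hb (fd_submod Xd) bdef (fd_span Xd) u.
(* Pythagoras for [b]; it yields existence and uniqueness of the minimiser. *)
have JE z : z \in Xd -> ls_functional G Kinv f z =
    ls_functional G Kinv f ud + 2^-1 * b (z - ud) (z - ud).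
  move=> zX; rewrite !(ls_functionalE hK hKadj hKsp) -Gu -!linearB.
  rewrite -/(b (z - u) (z - u)) -/(b (ud - u) (ud - u)) -mulrDr; congr (_ * _).
  have zuX : z - ud \in Xd by rewrite rpredB.
  have -> : z - u = 1 *: (z - ud) + (-1) *: (u - ud).
    by rewrite scale1r scaleN1r opprB addrA subrK.
  rewrite -(opprB u ud) (psd_expand hb) (psdC hb (z - ud)) orth//.
  rewrite (psdNl hb) (psdC hb _ (- _)) (psdNl hb) opprK.
  by ring.
have quasi w : w \in Xd -> L * `|G (u - ud)| ^+ 2 <= M * `|G (u - w)| ^+ 2.
  move=> wX; rewrite -!aE.
  by apply: (quasi_optimality ha hb (fd_submod Xd)) => //; rewrite (ltW L0).
pose c := Num.sqrt M / (gamma * Num.sqrt mu).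
have smu : 0 < Num.sqrt mu by rewrite sqrtr_gt0.
have Mge0 : 0 <= M by rewrite ltW.
have muge0 : 0 <= mu by rewrite ltW.
have gamma0 : 0 <= gamma by rewrite ltW.
have c0 : 0 <= c by rewrite divr_ge0 ?sqrtr_ge0// mulr_ge0// ltW.
have cea w : w \in Xd -> `|G (u - ud)| <= c * `|G (u - w)|.
  move=> wX; rewrite /c mulrAC ler_pdivlMr ?mulr_gt0//.
  rewrite -(@ler_pXn2r _ 2)// ?nnegrE ?mulr_ge0 ?sqrtr_ge0//.
  rewrite !exprMn (sqr_sqrtr Mge0) (sqr_sqrtr muge0) [leLHS]mulrC.
  exact: quasi.
have Xd0 : [set` Xd] !=set0 by exists 0; rewrite /= rpred0.
exists ud; split.
- apply/seteqP; split=> [z [zX zmin]|_ ->].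
    apply/eqP; rewrite -subr_eq0; apply/eqP; apply: bdef; first by rewrite rpredB.
    have := zmin ud udX; rewrite (JE z zX) gerDl pmulr_rle0 ?invr_gt0// => h.
    by apply/le_anti; rewrite h psd_ge0.
  split=> // w wX; rewrite (JE w wX) lerDl mulr_ge0 ?invr_ge0//.
  exact: psd_ge0 hb _.
- apply: ler_mul_inf => //; first by case: Xd0 => w wX; exists `|G (u - w)|, w.
  by move=> _ [w wX <-]; exact: cea.
- have cE : Num.sqrt (M / mu) * (opnorm G * opnorm Ginv / gamma) =
      opnorm Ginv * (c * opnorm G).
    rewrite /c sqrtrM ?(ltW M0)// sqrtrV ?(ltW mu0)//.
    by field; apply/andP; split; [rewrite gt_eqF|exact: lt0r_neq0 hgamma].
  rewrite {}cE; clearbody c; apply: ler_mul_inf.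
  + by rewrite !mulr_ge0 ?opnorm_ge0.
  + by case: Xd0 => w wX; exists `|u - w|, w.
  move=> _ [w wX <-]; rewrite -{1}(GK (u - ud)).
  apply: le_trans (le_opnorm _ Gic) _.
  rewrite -mulrA ler_wpM2l ?opnorm_ge0//; apply: le_trans (cea w wX) _.
  by rewrite -mulrA ler_wpM2l// le_opnorm.
Qed.
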